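(* Let $R$ be a standard graded algebra over a field $\Bbbk$. If $\mathcal{H}_R$ admits an embedding into $\mathcal{I}_R$, then $\mathcal{H}_R$ is a sublattice of $\mathbb{Z}[[\mathfrak{z}]]$, i.e., for all $H, \tilde H \in \mathcal{H}_R$ both $\max(H,\tilde H)$ and $\min(H,\tilde H)$ belong to $\mathcal{H}_R$.
   Context: $\mathbb{N}$ is the set of non-negative integers. A standard graded algebra over $\Bbbk$ is a graded $\Bbbk$-algebra $R=\bigoplus_{d\ge 0}R_d$ with $R_0=\Bbbk$, $R=\Bbbk[R_1]$ and $\dim_\Bbbk R_1<\infty$. $\mathcal{I}_R$ is the set of homogeneous ideals of $R$, partially ordered by inclusion. For $I\in\mathcal{I}_R$, $I_t$ is the $\Bbbk$-vector space of homogeneous elements of $I$ of degree $t$, and the Hilbert series of $I$ is $H_I(\mathfrak{z})=\sum_{t\in\mathbb{N}}(\dim_\Bbbk I_t)\mathfrak{z}^t\in\mathbb{Z}[[\mathfrak{z}]]$. For $H\in\mathbb{Z}[[\mathfrak{z}]]$, $H^t$ denotes the coefficient of $\mathfrak{z}^t$ in $H$. $\mathcal{H}_R=\{H_J : J\in\mathcal{I}_R\}$, partially ordered by $H\succcurlyeq H'$ iff $H^t\ge (H')^t$ for all $t\in\mathbb{N}$. One says that $\mathcal{H}_R$ admits an embedding (into $\mathcal{I}_R$) if there is an order-preserving injective map $\epsilon:\mathcal{H}_R\to\mathcal{I}_R$ with $H_{\epsilon(H)}=H$ for all $H\in\mathcal{H}_R$. For $H,\tilde H\in\mathbb{Z}[[\mathfrak{z}]]$,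 $\max(H,\tilde H)$ and $\min(H,\tilde H)$ are defined coefficientwise: $(\max(H,\tilde H))^t=\max\{H^t,\tilde H^t\}$ and $(\min(H,\tilde H))^t=\min\{H^t,\tilde H^t\}$ for all $t\in\mathbb{N}$; these are the join and meet that make $\mathbb{Z}[[\mathfrak{z}]]$ (with the coefficientwise order) a distributive lattice. *)

(* Defs.v *)
From mathcomp Require Import all_boot all_order all_algebra.
From mathcomp Require Import boolp classical_sets functions.

Set Implicit Arguments.
Unset Strict Implicit.
Unset Printing Implicit Defensive.

Import Order.TTheory GRing.Theory Num.Theory.

Local Open Scope classical_set_scope.
Local Open Scope ring_scope.

Section Dimension.
Variables (k : fieldType) (R : lmodType k).
Implicit Types V : set R.

Definition is_basis V n (b : 'I_n -> R) : Prop :=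
  [/\ forall i, V (b i),
      forall v, V v -> exists c : 'I_n -> k, v = \sum_i c i *: b i
    & forall c : 'I_n -> k, \sum_i c i *: b i = 0 -> forall i, c i = 0].

Definition finite_dimensional V : Prop :=
  exists n (b : 'I_n -> R), is_basis V b.

(* The dimension is only meaningful for a finite-dimensional subspace V (it is
   0 by default otherwise); lemma [dimE] says that it is the number of elements
   of any finite basis of V. *)
Definition dim V : nat :=
  xget 0%N [set n | exists b : 'I_n -> R, is_basis V b].

Lemma leq_basis V m n (b : 'I_m -> R) (b' : 'I_n -> R) :
  is_basis V b -> is_basis V b' -> (m <= n)%N.
Proof.
move=> [Vb _ freeb] [_ spanb' _].
have [C bE] := choice (fun i => spanb' _ (Vb i)).
pose M : 'M[k]_(m, n) := \matrix_(i, j) C i j.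
suff /eqP <- : row_free M by exact: rank_leq_col.
rewrite -kermx_eq0; apply/eqP/row_matrixP => i; rewrite row0.
have rM : row i (kermx M) *m M = 0 by apply/sub_kermxP/row_sub.
apply/rowP => j; rewrite [RHS]mxE.
apply: (freeb (fun j => row i (kermx M) 0 j)).
under eq_bigr => l _ do rewrite bE scaler_sumr.
rewrite exchange_big big1 // => l _.
under eq_bigr => a _ do rewrite scalerA.
rewrite -scaler_suml; have /rowP/(_ l) := rM; rewrite !mxE => sum0.
rewrite (_ : \sum_(a < m) _ = 0) ?scale0r // -[RHS]sum0.
by apply: eq_bigr => a _; rewrite !mxE.
Qed.

Lemma dimE V n (b : 'I_n -> R) : is_basis V b -> dim V = n.
Proof.
move=> Vb; rewrite /dim; case: xgetP => [d _ [b' Vb']|/(_ n) []]; last by exists b.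
by apply/eqP; rewrite eqn_leq (leq_basis Vb Vb') (leq_basis Vb' Vb).
Qed.

End Dimension.

Section GradedAlgebra.
Variables (k : fieldType) (R : comAlgType k).
Implicit Types (Rd V : nat -> set R) (I : set R).

Definition in_sum V (x : R) : Prop :=
  exists n (f : nat -> R), (forall d, V d (f d)) /\ x = \sum_(d < n) f d.

Record graded_algebra Rd : Prop := GradedAlgebra {
  graded_submod : forall d, GRing.submod_closed [in Rd d] ;
  graded_sum : forall x, in_sum Rd x ;
  graded_direct : forall n (f : nat -> R), (forall d, Rd d (f d)) ->
    \sum_(d < n) f d = 0 -> forall d, (d < n)%N -> f d = 0 ;
  graded_mul : forall d e x y, Rd d x -> Rd e y -> Rd (d + e)%N (x * y)
}.

Record standard_graded Rd : Prop := StandardGraded {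
  standard_graded_algebra : graded_algebra Rd ;
  standard_deg0 : Rd 0%N = range (fun c : k => c%:A) ;
  standard_gen :
    smallest (fun S : set R => GRing.subalg_closed [in S]) (Rd 1%N) = setT ;
  standard_fin : finite_dimensional (Rd 1%N)
}.

Definition ideal I : Prop :=
  [/\ I 0, forall x y, I x -> I y -> I (x + y) & forall a x, I x -> I (a * x)].

Definition homogeneous_ideal Rd I : Prop :=
  ideal I /\ forall x, I x -> in_sum (fun d => I `&` Rd d) x.

(* A power series with integer coefficients is represented by its sequence of
   coefficients, of type nat -> int. *)
Definition hilbert_series Rd I : nat -> int :=
  fun t => (dim (I `&` Rd t))%:Z.

Definition hilbert_poset Rd : set (nat -> int) :=
  [set hilbert_series Rd I | I in [set I | homogeneous_ideal Rd I]].

(* The map eps is only constrained on hilbert_poset Rd. *)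
Definition admits_embedding Rd : Prop :=
  exists eps : (nat -> int) -> set R,
    [/\ forall H, hilbert_poset Rd H -> homogeneous_ideal Rd (eps H),
        forall H, hilbert_poset Rd H -> hilbert_series Rd (eps H) = H,
        forall H H', hilbert_poset Rd H -> hilbert_poset Rd H' ->
          (forall t, H t <= H' t) -> eps H `<=` eps H'
      & set_inj (hilbert_poset Rd) eps].

End GradedAlgebra.

(* Main.v *)
Require Import Defs.
From mathcomp Require Import all_boot all_order all_algebra.
From mathcomp Require Import boolp classical_sets.

Import Order.Theory.

(** Write [I_t] for the degree [t] piece of a homogeneous ideal [I], and [eps]
    for the embedding.  The whole proof rests on one observation: the piece
    [(eps H)_t] depends on [H] only through the single number [H t], and grows
    with it ([embedding_piece_mono]).  To compare [I = eps H1] with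
    [J = eps H2] when [H1 t <= H2 t], forget what happens away from degree [t]:
    let [T I] be the truncation of [I] to degrees at least [t], and let [D J]
    be zero below degree [t], equal to [J] in degree [t] and to [R] above.  The
    Hilbert series of these ideals satisfy [T I <= I], [T I <= D J],
    [T J <= D J] and [T J <= J], so the images of these series under [eps]
    satisfy the four corresponding inclusions.  In degree [t] the first, third
    and fourth of these are inclusions between spaces of the same dimension,
    hence equalities, and the second one then says that [I_t] lies in [J_t].

    Consequently, for [I = eps H] and [J = eps H'], the spaces [I_t] and [J_t]
    are nested in every degree.  Their intersections are the pieces of an ideal
    with Hilbert series [H \min H'], and their unions, being subspaces, are the
    pieces of an ideal with Hilbert series [H \max H'].

    Equality of nested spaces of the same dimension requires the pieces of [R]
    to have finite dimension, which holds because [R] is generated in degree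
    one: [R_d] is spanned by the monomials of degree [d] in a basis of [R_1]
    ([piece_finite_dimensional]). *)

Set Implicit Arguments.
Unset Strict Implicit.
Unset Printing Implicit Defensive.

Import GRing.Theory Num.Theory.

(** * Dimension of subspaces of a finitely spanned space *)

Section LinearAlgebra.
Local Open Scope classical_set_scope.
Local Open Scope ring_scope.
Variables (k : fieldType) (R : lmodType k).
Implicit Types (V W : set R).

Definition spanned_by V n (b : 'I_n -> R) : Prop :=
  forall v, V v -> exists c : 'I_n -> k, v = \sum_i c i *: b i.

Definition free_family n (b : 'I_n -> R) : Prop :=
  forall c : 'I_n -> k, \sum_i c i *: b i = 0 -> forall i, c i = 0.

Lemma submod_closedP V :
  GRing.submod_closed [in V] <->
  V 0 /\ forall (a : k) u v, V u -> V v -> V (a *: u + v).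
Proof.
split=> [[V0 VD]|[V0 VD]]; split.
- exact: set_mem V0.
- move=> a u v Vu Vv; apply: set_mem.
  by apply: VD; apply: mem_set.
- exact: mem_set.
- move=> a u v /set_mem Vu /set_mem Vv; apply: mem_set; exact: VD.
Qed.

Section Subspace.
Variable V : set R.
Hypothesis V_sub : GRing.submod_closed [in V].

Lemma subspace0 : V 0.
Proof. by have /submod_closedP[] := V_sub. Qed.

Lemma subspaceD u v : V u -> V v -> V (u + v).
Proof.
by have /submod_closedP[_ VD] := V_sub; rewrite -{2}(scale1r u); apply: VD.
Qed.

Lemma subspaceZ (a : k) u : V u -> V (a *: u).
Proof.
have /submod_closedP[V0 VD] := V_sub => Vu.
by rewrite -(addr0 (a *: u)); apply: VD.
Qed.

Lemma subspace_sum (I : finType) (F : I -> R) :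
  (forall i, V (F i)) -> V (\sum_i F i).
Proof.
by move=> VF; elim/big_ind: _ => //; [exact: subspace0|exact: subspaceD].
Qed.

End Subspace.

(** Otherwise the coordinates of the family form a matrix with more rows than
    columns, and a nonzero row vector killed by that matrix is a nontrivial
    linear relation. *)
Lemma free_family_leq V m n (b : 'I_m -> R) (b' : 'I_n -> R) :
  (forall i, V (b i)) -> free_family b -> spanned_by V b' -> (m <= n)%N.
Proof.
move=> Vb free_b span_b'.
have [C bE] := choice (fun i => span_b' _ (Vb i)).
suff M_free : row_free (\matrix_(i, j) C i j).
  by rewrite -(eqP M_free) rank_leq_col.
apply/inj_row_free => v vM0; apply/rowP => i; rewrite mxE.
apply: (free_b (v 0)) => //.
under eq_bigr => j _ do rewrite bE scaler_sumr.
rewrite exchange_big big1 // => l _.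
under eq_bigr => j _ do rewrite scalerA.
rewrite -scaler_suml; have /rowP/(_ l) := vM0; rewrite !mxE => sum0.
rewrite (_ : \sum_(j < m) _ = 0) ?scale0r // -[RHS]sum0.
by apply: eq_bigr => j _; rewrite !mxE.
Qed.

Lemma free_family_extend m (b : 'I_m -> R) v :
    free_family b -> ~ (exists c : 'I_m -> k, v = \sum_i c i *: b i) ->
  free_family (fun i : 'I_m.+1 => oapp b v (unlift ord0 i)).
Proof.
move=> free_b v_out c; rewrite big_ord_recl unlift_none /=.
under eq_bigr => i _ do rewrite liftK /=.
move=> sum0.
have c0 : c ord0 = 0.
  apply: contrapT => /eqP c0; apply: v_out.
  exists (fun i => - ((c ord0)^-1 * c (lift ord0 i))).
  have /(congr1 (fun x => (c ord0)^-1 *: x)) := sum0.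
  rewrite scaler0 scalerDr scalerA mulVf // scale1r => /eqP.
  rewrite addr_eq0 => /eqP ->; rewrite scaler_sumr -sumrN.
  by apply: eq_bigr => i _; rewrite scalerA scaleNr.
move: sum0; rewrite c0 scale0r add0r => /free_b cl0 i.
by case: (unliftP ord0 i) => [j|] ->.
Qed.

(** The length of a spanning family of [V] bounds the free families in [W]. *)
Lemma subspace_finite_dimensional V W n (b : 'I_n -> R) :
  spanned_by V b -> W `<=` V -> finite_dimensional W.
Proof.
move=> span_b sWV.
pose P m :=
  `[< exists b' : 'I_m -> R, (forall i, W (b' i)) /\ free_family b' >].
have P0 : exists m, P m.
  exists 0%N; apply/asboolP; exists (fun=> 0).
  by split=> [|c _] [].
have Pn m : P m -> (m <= n)%N.
  move=> /asboolP[b' [Wb' free_b']].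
  by apply: free_family_leq free_b' span_b => i; apply: sWV.
(* a free family in W of maximal size spans W *)
case: (ex_maxnP P0 Pn) => m /asboolP[b' [Wb' free_b']] m_max.
exists m, b'; split=> // v Wv; apply: contrapT => v_out.
suff /m_max : P m.+1 by rewrite ltnn.
apply/asboolP; exists (fun i => oapp b' v (unlift ord0 i)); split.
  by move=> i; case: (unlift ord0 i) => [j|] //=.
exact: free_family_extend.
Qed.

Lemma dim_mono V W : finite_dimensional V -> W `<=` V ->
  (Defs.dim W <= Defs.dim V)%N.
Proof.
move=> [n [b bV]] sWV; have [_ span_b _] := bV.
have [m [b' bW]] := subspace_finite_dimensional span_b sWV.
rewrite (dimE bV) (dimE bW); have [Wb' _ free_b'] := bW.
by apply: free_family_leq free_b' span_b => i; apply: sWV.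
Qed.

(** A vector of [V] outside [W] would extend a basis of [W] to a free family
    longer than a spanning family of [V]. *)
Lemma dim_inj V W : GRing.submod_closed [in W] -> finite_dimensional V ->
  W `<=` V -> Defs.dim W = Defs.dim V -> W = V.
Proof.
move=> W_sub [n [b bV]] sWV; have [_ span_b _] := bV.
have [m [b' bW]] := subspace_finite_dimensional span_b sWV.
rewrite (dimE bV) (dimE bW) => emn; have [Wb' _ free_b'] := bW.
apply/seteqP; split=> // v Vv; apply: contrapT => nWv.
suff: (m.+1 <= n)%N by rewrite emn ltnn.
apply: (@free_family_leq V _ _ (fun i => oapp b' v (unlift ord0 i))) span_b.
  by move=> i; case: (unlift ord0 i) => [j|] //=; apply: sWV.
apply: free_family_extend => // -[c vE]; apply: nWv; rewrite vE.
by apply: subspace_sum => // i; apply: subspaceZ.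
Qed.

Lemma dim_set0 : Defs.dim [set 0 : R] = 0%N.
Proof.
apply: (@dimE _ _ _ _ (fun=> 0)); split=> [[]//|v -> |c _ []//].
by exists (fun=> 0); rewrite big_ord0.
Qed.

Lemma set0_submod : GRing.submod_closed [in [set 0 : R]].
Proof.
by apply/submod_closedP; split=> // a u v -> ->; rewrite scaler0 addr0.
Qed.

End LinearAlgebra.

(** * Sums of homogeneous elements *)

Section Graded.
Local Open Scope classical_set_scope.
Local Open Scope ring_scope.
Variables (k : fieldType) (R : comAlgType k).
Implicit Types (U V W : nat -> set R) (I : set R).

Section InSum.
Variable V : nat -> set R.
Hypothesis V_sub : forall d, GRing.submod_closed [in V d].

(** The number of summands can be taken as large as desired, which allows two
    expansions to be compared term by term. *)
Lemma in_sum_widen n (f : nat -> R) : (forall d, V d (f d)) ->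
  exists2 g : nat -> R, forall d, V d (g d) &
    forall m, (n <= m)%N -> \sum_(d < n) f d = \sum_(d < m) g d.
Proof.
move=> Vf; exists (fun d => if (d < n)%N then f d else 0) => [d|m le_nm].
  by case: ifP => // _; exact: subspace0.
by rewrite (big_ord_widen _ f le_nm) big_mkcond.
Qed.

Lemma in_sum_submod : GRing.submod_closed [in (in_sum V : set R)].
Proof.
apply/submod_closedP; split.
  by exists 0%N, (fun=> 0); rewrite big_ord0; split=> // d; apply: subspace0.
move=> a _ _ [n [f [Vf ->]]] [m [g [Vg ->]]].
have [f' Vf' fE] := in_sum_widen n Vf; have [g' Vg' gE] := in_sum_widen m Vg.
exists (maxn n m), (fun d => a *: f' d + g' d); split=> [d|].
  by apply: subspaceD => //; apply: subspaceZ.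
by rewrite (fE _ (leq_maxl n m)) (gE _ (leq_maxr n m)) scaler_sumr big_split.
Qed.

Lemma in_sum_homogeneous t x : V t x -> in_sum V x.
Proof.
move=> Vx; exists t.+1, (fun d => if d == t then x else 0); split=> [d|].
  by case: eqP => [->//|_]; exact: subspace0.
rewrite big_ord_recr /= eqxx big1 ?add0r // => d _.
by rewrite ltn_eqF.
Qed.

End InSum.

Lemma in_sum_mul U V W :
    (forall d, GRing.submod_closed [in W d]) ->
    (forall d e x y, U d x -> V e y -> W (d + e)%N (x * y)) ->
  forall x y, in_sum U x -> in_sum V y -> in_sum W (x * y).
Proof.
move=> W_sub UVW _ _ [n [f [Uf ->]]] [m [g [Vg ->]]].
rewrite big_distrlr /=.
apply: (subspace_sum (in_sum_submod W_sub)) => d.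
apply: (subspace_sum (in_sum_submod W_sub)) => e.
by apply: (in_sum_homogeneous W_sub); apply: UVW.
Qed.

Section Grading.
Variable Rd : nat -> set R.
Hypothesis R_graded : graded_algebra Rd.

Let Rd_sub := graded_submod R_graded.

(** The degree [t] component of an element of [R_t] is the element itself, and
    components are unique; so an expansion along the smaller spaces [V d] puts
    the element in [V t]. *)
Lemma in_sum_piece V t x :
    (forall d, GRing.submod_closed [in V d]) -> (forall d, V d `<=` Rd d) ->
  in_sum V x -> Rd t x -> V t x.
Proof.
move=> V_sub sVR [n [f [Vf xE]]] Rx.
have [g Vg gE] := in_sum_widen V_sub n Vf.
pose h d := - (if d == t then x else 0) + g d.
have Rh d : Rd d (h d).
  apply: subspaceD => //; last exact: sVR.
  rewrite -scaleN1r; apply: subspaceZ => //.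
  by case: eqP => [->//|_]; exact: subspace0.
have sum0 : \sum_(d < maxn n t.+1) h d = 0.
  have tm : (t < maxn n t.+1)%N by rewrite leq_max ltnSn orbT.
  rewrite big_split /= -gE ?leq_maxl // -xE sumrN (bigD1 (Ordinal tm)) //= eqxx.
  rewrite big1 ?addr0 ?addNr // => d; rewrite -val_eqE /= => /negPf -> //.
have /(_ t) := graded_direct R_graded Rh sum0.
rewrite /h eqxx leq_max ltnSn orbT => /(_ isT)/eqP.
by rewrite addrC subr_eq0 => /eqP <-.
Qed.

(** * Homogeneous ideals given by their pieces *)

Definition ideal_pieces V : Prop :=
  [/\ forall d, GRing.submod_closed [in V d],
      forall d, V d `<=` Rd d
    & forall d e a x, Rd d a -> V e x -> V (d + e)%N (a * x)].

(** The sums of elements of the [V t] form a homogeneous ideal, whose piece of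
    degree [t] is exactly [V t]; so Hilbert series can be exhibited degree by
    degree. *)
Lemma ideal_pieces_hilbert V : ideal_pieces V ->
  hilbert_poset Rd (fun t => (Defs.dim (V t))%:Z).
Proof.
move=> [V_sub sVR V_mul]; exists (in_sum V); last first.
  apply/funext => t; congr (Posz (Defs.dim _)); apply/seteqP; split=> x.
    by case=> Vx Rx; apply: in_sum_piece Vx Rx.
  by move=> Vx; split; [exact: in_sum_homogeneous Vx|exact: sVR].
split; first split.
- exact: (subspace0 (in_sum_submod V_sub)).
- exact: (subspaceD (in_sum_submod V_sub)).
- move=> a x; apply: (in_sum_mul V_sub) (graded_sum R_graded a).
  exact: V_mul.
- move=> _ [n [f [Vf ->]]]; exists n, f; split=> // d.
  by split; [exact: in_sum_homogeneous (Vf d)|exact: sVR].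
Qed.

Lemma ideal_pieces_of_ideal I :
  homogeneous_ideal Rd I -> ideal_pieces (fun d => I `&` Rd d).
Proof.
move=> [[I0 ID IM] _]; split=> [d|d x []//|d e a x Ra [Ix Rx]]; last first.
  by split; [exact: IM|exact: graded_mul].
apply/submod_closedP; split=> [|a u v [Iu Ru] [Iv Rv]].
  by split=> //; exact: subspace0.
split; last by apply: subspaceD => //; exact: subspaceZ.
by apply: ID => //; rewrite -mulr_algl; exact: IM.
Qed.

Lemma ideal_pieces_full : ideal_pieces Rd.
Proof. by split=> [//|d x //|d e a x]; exact: graded_mul. Qed.

(** With [V = V'] this is truncation to degrees at least [t]; with [V'] the
    grading of [R] it isolates the piece of degree [t], since an ideal may be
    enlarged to all of [R] above that degree. *)
Definition cut t V V' s :=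
  if (s < t)%N then [set 0] else if s == t then V s else V' s.

Lemma ideal_pieces_cut t V V' :
  ideal_pieces V -> ideal_pieces V' -> V t `<=` V' t ->
  ideal_pieces (cut t V V').
Proof.
move=> [V_sub sVR V_mul] [V'_sub sV'R V'_mul] sVV'.
rewrite /cut; split=> [d|d|d e a x Ra].
- by case: ifP => _; [exact: set0_submod|case: eqP].
- case: ifP => _; last by case: eqP => [->|_].
  by move=> _ ->; exact: subspace0.
case: (ltnP e t) => [_ ->|le_te].
  rewrite mulr0; case: ifP => // _.
  by case: eqP => _; exact: subspace0.
rewrite ltnNge (leq_trans le_te (leq_addl _ _)) /=.
case: (eqVneq e t) => [-> Vx|ne_et V'x].
  case: (eqVneq d 0%N) => [d0|d_neq0].
    by rewrite d0 add0n eqxx -[t]add0n; apply: V_mul => //; rewrite -d0.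
  rewrite -[X in _ == X]add0n eqn_add2r (negPf d_neq0).
  by apply: V'_mul => //; exact: sVV'.
have lt_te : (t < e)%N by rewrite ltn_neqAle eq_sym ne_et.
rewrite gtn_eqF ?(leq_trans lt_te) ?leq_addl //.
exact: V'_mul.
Qed.

End Grading.

(** * Finite dimension of the pieces of a standard graded algebra *)

Section Monomials.
Variables (n : nat) (b : 'I_n -> R).

Definition monomial d (s : d.-tuple 'I_n) : R := \prod_(i <- s) b i.

Definition monomial_span d : set R :=
  [set x | exists c : d.-tuple 'I_n -> k, x = \sum_s c s *: monomial s].

Lemma monomial_span_submod d : GRing.submod_closed [in monomial_span d].
Proof.
apply/submod_closedP; split.
  by exists (fun=> 0); rewrite big1 // => s _; rewrite scale0r.
move=> a _ _ [c ->] [c' ->]; exists (fun s => a * c s + c' s).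
rewrite scaler_sumr -big_split; apply: eq_bigr => s _.
by rewrite scalerDl scalerA.
Qed.

Lemma monomial_in_span d (s : d.-tuple 'I_n) : monomial_span d (monomial s).
Proof.
exists (fun s' => (s' == s)%:R); rewrite (bigD1 s) //= eqxx scale1r.
by rewrite big1 ?addr0 // => s' /negPf ->; rewrite scale0r.
Qed.

Lemma monomial_span_mul d e x y :
  monomial_span d x -> monomial_span e y -> monomial_span (d + e)%N (x * y).
Proof.
have sub := monomial_span_submod (d + e).
move=> [c ->] [c' ->]; rewrite big_distrlr /=.
apply: (subspace_sum sub) => s; apply: (subspace_sum sub) => s'.
rewrite -scalerAl -scalerAr; do 2! apply: (subspaceZ sub).
rewrite (_ : _ * _ = monomial (cat_tuple s s')); first exact: monomial_in_span.
by rewrite /monomial big_cat.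
Qed.

Lemma monomial_span_subalg :
  GRing.subalg_closed [in (in_sum monomial_span : set R)].
Proof.
have /submod_closedP[S0 SD] := in_sum_submod monomial_span_submod.
split.
- apply: mem_set; apply: (in_sum_homogeneous monomial_span_submod).
  have := monomial_in_span [tuple]; rewrite /monomial big_nil; exact.
- by move=> a u v /set_mem Su /set_mem Sv; apply/mem_set/SD.
- move=> u v /set_mem Su /set_mem Sv; apply: mem_set.
  apply: in_sum_mul Su Sv; first exact: monomial_span_submod.
  exact: monomial_span_mul.
Qed.

End Monomials.

Section StandardGraded.
Variable Rd : nat -> set R.
Hypothesis R_standard : standard_graded Rd.

Let R_graded := standard_graded_algebra R_standard.

(** The sums of linear combinations of monomials in a basis of [R_1] form a
    subalgebra containing [R_1], hence are all of [R].  Since the monomials of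
    degree [d] lie in [R_d], uniqueness of the homogeneous components shows that
    they span [R_d]. *)
Lemma piece_finite_dimensional d : finite_dimensional (Rd d).
Proof.
have [n [b [Rb span_b _]]] := standard_fin R_standard.
have mon_sub := monomial_span_submod b.
have span_sub e : monomial_span b e `<=` Rd e.
  move=> _ [c ->].
  apply: (subspace_sum (graded_submod R_graded e)) => s.
  apply: (subspaceZ (graded_submod R_graded e)).
  rewrite /monomial -[in Rd _](size_tuple s).
  elim: (tval s) => [|i l IHl].
    rewrite big_nil (standard_deg0 R_standard).
    by exists 1; rewrite ?scale1r.
  by rewrite big_cons; apply: (graded_mul R_graded (d := 1)).
have gen x : in_sum (monomial_span b) x.
  have : smallest (fun S : set R => GRing.subalg_closed [in S]) (Rd 1%N) x.
    by rewrite (standard_gen R_standard).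
  apply: smallest_sub; first exact: monomial_span_subalg.
  move=> y /span_b[c ->]; apply: (subspace_sum (in_sum_submod mon_sub)) => i.
  apply: (subspaceZ (in_sum_submod mon_sub)).
  apply: (in_sum_homogeneous mon_sub (t := 1)).
  have := monomial_in_span b [tuple i].
  by rewrite /monomial big_seq1.
apply: (@subspace_finite_dimensional _ _ (Rd d) (Rd d) _
  (fun i => monomial b (enum_val i : d.-tuple 'I_n))) => // x Rx.
have [c ->] := in_sum_piece R_graded mon_sub span_sub (gen x) Rx.
exists (fun i => c (enum_val i)).
rewrite (reindex (@enum_val _ {: d.-tuple 'I_n})) //=.
exact/onW_bij/enum_val_bij.
Qed.

Lemma dim_piece_mono d (V W : set R) :
  V `<=` Rd d -> W `<=` V -> (Defs.dim W <= Defs.dim V)%N.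
Proof.
move=> sVR; apply: dim_mono.
have [n [b [_ span_b _]]] := piece_finite_dimensional d.
exact: subspace_finite_dimensional span_b sVR.
Qed.

Lemma dim_piece_inj d (V W : set R) : GRing.submod_closed [in W] ->
  V `<=` Rd d -> W `<=` V -> Defs.dim W = Defs.dim V -> W = V.
Proof.
move=> W_sub sVR; apply: dim_inj => //.
have [n [b [_ span_b _]]] := piece_finite_dimensional d.
exact: subspace_finite_dimensional span_b sVR.
Qed.

(** * The pieces of an embedding *)

Section Embedding.
Variable eps : (nat -> int) -> set R.
Hypothesis eps_ideal :
  forall H, hilbert_poset Rd H -> homogeneous_ideal Rd (eps H).
Hypothesis eps_hilbert :
  forall H, hilbert_poset Rd H -> hilbert_series Rd (eps H) = H.
Hypothesis eps_mono : forall H H', hilbert_poset Rd H -> hilbert_poset Rd H' ->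
  (forall t, H t <= H' t) -> eps H `<=` eps H'.

Let piece H t := eps H `&` Rd t.

Lemma piece_pieces H : hilbert_poset Rd H -> ideal_pieces Rd (piece H).
Proof. by move=> /eps_ideal; exact: ideal_pieces_of_ideal. Qed.

Lemma dim_piece H t : hilbert_poset Rd H -> (Defs.dim (piece H t))%:Z = H t.
Proof. by move=> /eps_hilbert E; rewrite -[in RHS]E. Qed.

Lemma embedding_piece_eq H H' t : hilbert_poset Rd H -> hilbert_poset Rd H' ->
  (forall s, H s <= H' s) -> H t = H' t -> piece H t = piece H' t.
Proof.
move=> HH HH' leHH' eqt; have [sub _ _] := piece_pieces HH.
apply: (dim_piece_inj (d := t)) => // [x []//||].
  by apply: setSI; exact: eps_mono.
by apply/eqP; rewrite -eqz_nat !dim_piece // eqt.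
Qed.

(** The ideals [T I], [T J] and [D J] that serve to compare [I = eps H] and
    [J = eps H'] are those with pieces [cut t I I], [cut t J J] and
    [cut t J Rd]; they are only used through their Hilbert series. *)
Lemma embedding_piece_mono H H' t : hilbert_poset Rd H ->
  hilbert_poset Rd H' -> H t <= H' t -> piece H t `<=` piece H' t.
Proof.
move=> HH HH' leHH't.
have PH := piece_pieces HH; have PH' := piece_pieces HH'.
have cutH V V' : ideal_pieces Rd V -> ideal_pieces Rd V' -> V t `<=` V' t ->
    hilbert_poset Rd (fun s => (Defs.dim (cut t V V' s))%:Z).
  by move=> PV PV' sVV'; apply/ideal_pieces_hilbert/ideal_pieces_cut.
have cutE V V' : Defs.dim (cut t V V' t) = Defs.dim (V t).
  by rewrite /cut ltnn eqxx.
have trunc_le G : hilbert_poset Rd G ->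
    forall s, (Defs.dim (cut t (piece G) (piece G) s))%:Z <= G s.
  move=> HG s; rewrite -[leRHS]dim_piece // lez_nat.
  by rewrite /cut if_same; case: ifP => _ //; rewrite dim_set0.
have subR G s : piece G s `<=` Rd s by move=> x [].
have TH := cutH _ _ PH PH (fun x => id).
have TH' := cutH _ _ PH' PH' (fun x => id).
have DH' := cutH _ _ PH' (ideal_pieces_full R_graded) (subR _ _).
rewrite -(embedding_piece_eq (t := t) TH HH) ?cutE ?dim_piece //; last first.
  exact: trunc_le.
rewrite -(embedding_piece_eq (t := t) TH' HH') ?cutE ?dim_piece //; last first.
  exact: trunc_le.
rewrite (embedding_piece_eq (t := t) TH' DH') ?cutE //; last first.
  move=> s; rewrite lez_nat /cut; case: ifP => // _; case: eqP => // _.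
  exact: (@dim_piece_mono s).
apply: setSI; apply: eps_mono => // s; rewrite lez_nat /cut.
case: ifP => // _; case: eqP => [->|_].
  by rewrite -lez_nat !dim_piece.
exact: (@dim_piece_mono s).
Qed.

Lemma embedding_min H H' : hilbert_poset Rd H -> hilbert_poset Rd H' ->
  hilbert_poset Rd (H \min H').
Proof.
move=> HH HH'.
have [sub sR mul] := piece_pieces HH; have [sub' _ mul'] := piece_pieces HH'.
rewrite (_ : H \min H' = fun t => (Defs.dim (piece H t `&` piece H' t))%:Z).
  apply: (ideal_pieces_hilbert R_graded); split=> [d|d x [/sR//]|].
    apply/submod_closedP; split; first by split; exact: subspace0.
    move=> a u v [Iu Ju] [Iv Jv].
    by split; apply: subspaceD => //; exact: subspaceZ.
  by move=> d e a x Ra [Ix Jx]; split; [exact: mul|exact: mul'].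
apply/funext => t /=; case: (leP (H t) (H' t)) => [le_t|/ltW le_t].
  by rewrite (setIidl (embedding_piece_mono HH HH' le_t)) dim_piece.
by rewrite (setIidr (embedding_piece_mono HH' HH le_t)) dim_piece.
Qed.

(** A union of two subspaces is a subspace here because they are nested. *)
Lemma embedding_max H H' : hilbert_poset Rd H -> hilbert_poset Rd H' ->
  hilbert_poset Rd (H \max H').
Proof.
move=> HH HH'.
have [sub sR mul] := piece_pieces HH; have [sub' sR' mul'] := piece_pieces HH'.
have UE t :
    piece H t `|` piece H' t = if H t <= H' t then piece H' t else piece H t.
  case: (leP (H t) (H' t)) => [le_t|/ltW le_t].
    exact: (setUidr (embedding_piece_mono HH HH' le_t)).
  exact: (setUidl (embedding_piece_mono HH' HH le_t)).
rewrite (_ : H \max H' = fun t => (Defs.dim (piece H t `|` piece H' t))%:Z).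
  apply: (ideal_pieces_hilbert R_graded); split=> [d|d x [/sR|/sR']//|].
    by rewrite UE; case: ifP.
  by move=> d e a x Ra [Ix|Jx]; [left; exact: mul|right; exact: mul'].
apply/funext => t /=; rewrite UE.
by case: (leP (H t) (H' t)) => _; rewrite dim_piece.
Qed.

End Embedding.
End StandardGraded.
End Graded.

Theorem proposition2p7 (k : fieldType) (R : comAlgType k) (Rd : nat -> set R)
    (R_standard : standard_graded Rd) (R_embedding : admits_embedding Rd)
    (H H' : nat -> int) (H_in : hilbert_poset Rd H)
    (H'_in : hilbert_poset Rd H') :
  hilbert_poset Rd (H \max H') /\
  hilbert_poset Rd (H \min H').
Proof.
have [eps [eps_ideal eps_hilbert eps_mono _]] := R_embedding.
split.
- exact: embedding_max eps_mono _ _ H_in H'_in.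
- exact: embedding_min eps_mono _ _ H_in H'_in.
Qed.
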